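(* Let $(\Omega,\Sigma,\mu)$ be a measure space with $\mu:\Sigma\to[0,\infty]$ a locally determined positive measure, let $X$ be a Banach space over $\mathbb{K}$ ($\mathbb{R}$ or $\mathbb{C}$), let $F:\Omega\to X$ be locally Bochner integrable, and let $\nu_F:\Sigma^f\to X$ be the vector measure $\nu_F(B)=\mathbb{P}\text{-}\int_BF\,d\mu$, $B\in\Sigma^f$. Then $$|\nu_F|(A)=\int_A\|F\|_X\,d\mu,\qquad\forall A\in\Sigma.$$
   Context: $\Omega$ is a nonempty set, $\Sigma$ a $\sigma$-algebra on $\Omega$, $\Sigma^f=\{B\in\Sigma:\mu(B)<\infty\}$. $\mu$ is semi-finite if every $A\in\Sigma$ with $\mu(A)>0$ contains $B\in\Sigma^f$ with $\mu(B)>0$; $\mu$ is locally determined if it is semi-finite and $\Sigma=\{A\subset\Omega: A\cap B\in\Sigma\ \forall B\in\Sigma^f\}$. $F:\Omega\to X$ is strongly $\mu$-measurable if it is the pointwise $\mu$-a.e. limit of a sequence of $X$-valued simple ($\Sigma$-measurable, finitely valued) functions whose supports have finite $\mu$-measure. Functions that agree $\mu$-a.e. with $\Sigma$-measurable ones are integrated in the obvious way. $F$ is Bochner integrable, $F\in\mathbb{B}(\mu,X)$, if it is strongly $\mu$-measurable and $\|F\|_X\in L^1(\mu)$. $F$ is locally Bochner integrable if it is strongly $\mu$-measurable and $\chi_BF\in\mathbb{B}(\mu,X)$ for all $B\in\Sigma^f$. A Bochner integrable function $G$ is Pettis integrable with the same integral: $\mathbb{P}\text{-}\int_AG\,d\mu=\mathbb{B}\text{-}\int_AG\,d\mu$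 (Bochner integral) is the unique $x_A\in X$ with $\langle x_A,x^*\rangle=\int_A\langle G,x^*\rangle d\mu$ for all $x^*\in X^*$. For $B\in\Sigma^f$, $\mathbb{P}\text{-}\int_BF\,d\mu:=\mathbb{P}\text{-}\int_B\chi_BF\,d\mu$. $\Sigma^f$ is a $\delta$-ring (a ring closed under countable intersections). A vector measure $\nu:\Sigma^f\to X$ is a set function with $\nu(\bigcup_nB_n)=\sum_n\nu(B_n)$ for every pairwise disjoint sequence in $\Sigma^f$ with union in $\Sigma^f$. The variation of $\nu$ is the measure on $\Sigma$ given by $|\nu|(A)=\sup\sum_j\|\nu(A_j)\|_X\in[0,\infty]$ over finite families of pairwise disjoint sets $A_j\in\Sigma^f$, $A_j\subset A$. *)

(* Defs.v *)
From HB Require Import structures.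
From mathcomp Require Import all_boot all_order all_algebra.
From mathcomp Require Import complex.
From mathcomp Require Import all_classical all_reals all_analysis.
From mathcomp Require Import measurable_realfun.
Set Implicit Arguments.
Unset Strict Implicit.
Unset Printing Implicit Defensive.
Import Order.TTheory GRing.Theory Num.Theory.
Import numFieldNormedType.Exports.
Local Open Scope classical_set_scope.
Local Open Scope ring_scope.
Local Open Scope ereal_scope.

(* The scalar field K is the real field R or the complex field R[i]. *)
Variant RC (R : realType) : numFieldType -> Type :=
| RC_real : RC R R
| RC_complex : RC R R[i].

Definition re (R : realType) (K : numFieldType) (k : RC R K) : K -> R :=
  match k in RC _ K return K -> R with
  | RC_real => id
  | RC_complex => @complex.Re R
  end.

Definition im (R : realType) (K : numFieldType) (k : RC R K) : K -> R :=
  match k in RC _ K return K -> R with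
  | RC_real => fun=> 0%R
  | RC_complex => @complex.Im R
  end.

(* The norm of a normed module over K takes its values in K; they are real and
   nonnegative there, so taking the real part only changes the type. *)
Definition rnorm (R : realType) (K : numFieldType) (k : RC R K)
  (X : normedModType K) (x : X) : R := re k `|x|%R.

Section measure_spaces.
Context d (T : measurableType d) (R : realType).
Variable mu : {measure set T -> \bar R}.

Definition finite_measurable : set (set T) :=
  [set B | measurable B /\ mu B < +oo].

Definition semi_finite := forall A, measurable A -> 0 < mu A ->
  exists B, [/\ finite_measurable B, B `<=` A & 0 < mu B].

Definition locally_determined := semi_finite /\
  measurable = [set A : set T | forall B, finite_measurable B ->
                                          measurable (A `&` B)].

End measure_spaces.

Section ae_integral.
Context d (T : measurableType d) (R : realType).
Variable mu : {measure set T -> \bar R}.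
Import HBNNSimple.

Lemma ge0_ae_le_integral_gen (f g : T -> \bar R) :
  (forall x, 0 <= f x) -> (forall x, 0 <= g x) -> f = g %[ae mu] ->
  \int[mu]_x f x <= \int[mu]_x g x.
Proof.
move=> f0 g0 [N [mN N0 fgN]]; rewrite !ge0_integralTE//.
apply: ge_ereal_sup => _ [h hf <-].
have mCN : measurable (~` N) by exact: measurableC.
have hN x : proj_nnsfun h mCN x = (h x * (x \in ~` N)%:R)%R by [].
apply: (@le_trans _ _ (sintegral mu (proj_nnsfun h mCN))); last first.
  apply: ereal_sup_ubound; exists (proj_nnsfun h mCN) => // x.
  rewrite hN; have [xN|xN] := boolP (x \in ~` N); last by rewrite mulr0.
  rewrite mulr1 (_ : g x = f x); first exact: hf.
  apply/esym; apply: contrapT => fgx.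
  by move: xN; rewrite inE; apply; apply: fgN => /= /(_ I).
have sE (h' : {nnsfun T >-> R}) : sintegral mu h' = \int[mu]_x (h' x)%:E.
  by rewrite integral_nnsfun// patch_setT.
rewrite !sE (ge0_ae_eq_integral (g := fun x => (proj_nnsfun h mCN x)%:E))//.
- exact/measurable_EFinP.
- exact/measurable_EFinP.
- by move=> x _; rewrite lee_fin.
- by move=> x _; rewrite lee_fin.
- exists N; split => // x hx; apply: contrapT => xN; apply: hx => _.
  by rewrite hN mem_set// mulr1.
Qed.

(* The library integral is not affected by changing a function on a mu-null set,
   even if this destroys measurability.  Hence it can be used as such for
   functions that only agree mu-a.e. with a measurable one. *)
Lemma ae_eq_integral_gen (D : set T) (f g : T -> \bar R) :
  f = g %[ae mu in D] -> \int[mu]_(x in D) f x = \int[mu]_(x in D) g x.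
Proof.
move=> fg; rewrite integral_mkcond [RHS]integral_mkcond.
have {fg}/ae_eq_funeposneg[fgp fgn] : ae_eq mu setT (f \_ D) (g \_ D).
  by apply: filterS fg => x fg _; rewrite !patchE; case: ifP => // /[!inE].
rewrite integralE [RHS]integralE; congr (_ - _); apply/eqP; rewrite eq_le.
  by rewrite !ge0_ae_le_integral_gen//; apply: filterS fgp => x /[swap] _ ->.
by rewrite !ge0_ae_le_integral_gen//; apply: filterS fgn => x /[swap] _ ->.
Qed.

Definition ae_integrable (f : T -> R) :=
  exists2 g : T -> R, mu.-integrable setT (EFin \o g) & f = g %[ae mu].

End ae_integral.

Section vector_integration.
Context d (T : measurableType d) (R : realType).
Variable mu : {measure set T -> \bar R}.
Context (K : numFieldType) (k : RC R K) (X : normedModType K).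

Definition simple_finite_support (s : T -> X) :=
  [/\ finite_set (range s), forall x, measurable (s @^-1` [set x]) &
      mu [set t | s t != 0%R] < +oo].

Definition strongly_measurable (F : T -> X) :=
  exists s : nat -> T -> X, (forall n, simple_finite_support (s n)) /\
    \forall t \ae mu, (fun n => s n t) @ \oo --> F t.

Definition bochner_integrable (F : T -> X) :=
  strongly_measurable F /\ ae_integrable mu (fun t => rnorm k (F t)).

Definition chi (B : set T) (F : T -> X) : T -> X :=
  fun t => ((\1_B t : K) *: F t)%R.

Definition locally_bochner_integrable (F : T -> X) :=
  strongly_measurable F /\
  forall B, finite_measurable mu B -> bochner_integrable (chi B F).

(* [z] is the integral over A of the K-valued function g; the equations in
   \bar R include the convergence of the integrals. *)
Definition is_scalar_integral (A : set T) (g : T -> K) (z : K) :=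
  \int[mu]_(t in A) (re k (g t))%:E = (re k z)%:E /\
  \int[mu]_(t in A) (im k (g t))%:E = (im k z)%:E.

(* The topological dual of X consists of the continuous linear maps to K, and
   K^o is K as a normed module over itself. *)
Definition is_pettis_integral (A : set T) (G : T -> X) (x : X) :=
  forall xs : {linear X -> K^o}, continuous xs ->
    is_scalar_integral A (fun t => xs (G t)) (xs x).

(* By Hahn-Banach there is at most one such vector; 0 is a dummy value for the
   case that there is none. *)
Definition pettis_integral (A : set T) (G : T -> X) : X :=
  xget 0%R [set x | is_pettis_integral A G x].

(* The set function nu_F; it is only meaningful on sets of finite measure. *)
Definition pettis_measure (F : T -> X) (B : set T) : X :=
  pettis_integral B (chi B F).

Definition vector_variation (nu : set T -> X) (A : set T) : \bar R :=
  ereal_sup [set v | exists n, exists E : 'I_n -> set T,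
    [/\ forall j, finite_measurable mu (E j),
        forall j, E j `<=` A,
        trivIset setT E &
        v = (\sum_(j < n) rnorm k (nu (E j)))%:E]].

End vector_integration.

(* Main.v *)
Require Import Defs.
From HB Require Import structures.
From mathcomp Require Import all_boot all_order all_algebra.
From mathcomp Require Import complex.
From mathcomp Require Import all_classical all_reals all_analysis.
From mathcomp Require Import measurable_realfun.
From mathcomp Require Import ring.
Set Implicit Arguments.
Unset Strict Implicit.
Unset Printing Implicit Defensive.
Import Order.TTheory GRing.Theory Num.Theory.
Import numFieldNormedType.Exports.
Local Open Scope classical_set_scope.
Local Open Scope ring_scope.
Local Open Scope ereal_scope.

(** The variation of an indefinite integral is the integral of the norm.  On a
null set [F] may be changed so that it becomes an everywhere pointwise limit
[f] of simple functions with supports of finite measure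
([strongly_measurable_simple_limit]); this makes every real function attached
to it, such as its norm, measurable and does not affect any integral.

Let [nu] be the indefinite integral.  For [<=], each [B] of finite measure
satisfies [rnorm k (nu B) <= \int[mu]_(t in B) rnorm k (f t)], and summing this over
disjoint pieces of [A] bounds the variation.

For [>=], [f] vanishes outside the union of the supports of its approximating
functions, so by monotone convergence it suffices to bound the integral over a
subset [B] of [A] of finite measure.  There [f] is approximated in the mean by
a simple function ([simple_approximation], by truncation and dominated
convergence).  On each level set of that function [f] is close to a constant,
and for a constant the norm of the integral is the integral of the norm; hence
the level sets, cut down to [B], form a partition whose variation sum is as
close to the integral of the norm as desired.

Two pieces of functional analysis support this.  Completeness of [X] provides
the vector integral as a limit of integrals of simple functions
([has_integral_exists]).  The Hahn-Banach theorem shows that this vector is the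
only one with the required scalar integrals ([has_integral_pettis]) and yields
the norm estimate [rnorm_dist_has_integral], from which everything about vector
integrals is deduced by comparing integrals of real functions.  The real and
the complex case are treated together by regarding [X] as a real vector space;
[has_integral] is accordingly expressed with bounded real-linear functionals,
of which the real and imaginary parts of [K]-linear functionals are special
cases. *)

(** * The Hahn-Banach theorem for sublinear functionals *)

Section hahn_banach.
Local Open Scope ring_scope.
Context (R : realType) (V : lmodType R).

Definition sublinear (p : V -> R) :=
  (forall x y, p (x + y) <= p x + p y) /\
  (forall r x, 0 <= r -> p (r *: x) <= r * p x).

Lemma sublinear0 p : sublinear p -> p 0 = 0.
Proof.
move=> [pD pZ]; apply/eqP; rewrite eq_le; apply/andP; split.
  by rewrite -(scale0r 0) (le_trans (pZ _ _ _))// mul0r.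
by have := pD 0 0; rewrite addr0 -{1}(add0r (p 0)) lerD2r.
Qed.

Lemma sublinearN p x : sublinear p -> - p (- x) <= p x.
Proof.
move=> sp; rewrite -subr_ge0 opprK -(sublinear0 sp) -(subrr x).
exact: sp.1.
Qed.

Lemma sublinearZ p r x : sublinear p -> 0 <= r -> p (r *: x) = r * p x.
Proof.
move=> sp r0; apply/eqP; rewrite eq_le sp.2//=.
have [->|rn0] := eqVneq r 0; first by rewrite mul0r scale0r sublinear0.
have r0' : 0 < r by rewrite lt_def rn0.
rewrite -ler_pdivlMl// -{1}(scalerK rn0 x); apply: sp.2.
by rewrite invr_ge0.
Qed.

(** Both infima below, over a chain of functionals and over the half-line in
[descent], are sublinear for this common reason: a sum of values of two
members, or a nonnegative multiple of a value, is at least some value of a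
single member of the family. *)
Lemma inf_sublinear (I : Type) (A : set I) (f : I -> V -> R) :
  A !=set0 ->
  (forall x, has_lbound [set f i x | i in A]) ->
  (forall i j x y, A i -> A j ->
     exists2 l, A l & f l (x + y) <= f i x + f j y) ->
  (forall i r x, A i -> 0 <= r -> exists2 l, A l & f l (r *: x) <= r * f i x) ->
  sublinear (fun x => inf [set f i x | i in A]).
Proof.
move=> [i0 Ai0] lbf fD fZ.
have f_ge i x : A i -> inf [set f i x | i in A] <= f i x.
  by move=> Ai; apply: ge_inf => //; exists i.
have le_f c x : (forall i, A i -> c <= f i x) ->
    c <= inf [set f i x | i in A].
  move=> h; apply: lb_le_inf => [|_ [i Ai <-]]; last exact: h.
  by exists (f i0 x), i0.
split=> [x y|r x r0].
  rewrite -lerBlDr; apply/(le_f _ _) => i Ai.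
  rewrite lerBlDr [leRHS]addrC -lerBlDr.
  apply/(le_f _ _) => j Aj; rewrite lerBlDr [leRHS]addrC.
  by have [l Al] := fD _ _ x y Ai Aj; apply: le_trans; exact: f_ge.
have [->|rn0] := eqVneq r 0.
  have [l Al] := fZ i0 0 x Ai0 (lexx _); rewrite !mul0r.
  by apply: le_trans; exact: f_ge.
have {rn0}r0' : 0 < r by rewrite lt_def rn0.
rewrite mulrC -ler_pdivrMr//; apply/(le_f _ _) => i Ai; rewrite ler_pdivrMr//.
have [l Al] := fZ _ _ x Ai r0; rewrite mulrC.
by apply: le_trans; exact: f_ge.
Qed.

Section minimal.
Variable p : V -> R.
Hypothesis sp : sublinear p.

(** The largest sublinear functional below [p] whose value at [- y] is at most
[- p y]: writing [x] as [(x + t *: y) + t *: (- y)] bounds any such functional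
by each member of the family. *)
Definition descent (y x : V) : R :=
  inf [set p (x + t *: y) - t * p y | t in [set t | 0 <= t]].

Let descent_lb y x :
  has_lbound [set p (x + t *: y) - t * p y | t in [set t | 0 <= t]].
Proof.
exists (- p (- x)) => _ [t /= t0 <-].
rewrite lerBrDr -(sublinearZ y sp t0) addrC lerBlDr.
by have := sp.1 (- x) (x + t *: y); rewrite addKr addrC.
Qed.

Lemma sublinear_descent y : sublinear (descent y).
Proof.
apply: (@inf_sublinear R [set t | 0 <= t]
  (fun t x => p (x + t *: y) - t * p y)).
- by exists 0 => /=.
- exact: descent_lb.
- move=> s t x z /= s0 t0; exists (s + t); first exact: addr_ge0.
  rewrite scalerDl (addrACA x z) [leRHS]addrACA -opprD -mulrDl.
  by rewrite lerD2r sp.1.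
- move=> t r x /= t0 r0; exists (r * t); first exact: mulr_ge0.
  by rewrite -scalerA -scalerDr mulrBr [in leRHS]mulrA lerD2r sp.2.
Qed.

Lemma descent_le y x : descent y x <= p x.
Proof.
by apply: ge_inf => //; exists 0 => /=; rewrite // scale0r addr0 mul0r subr0.
Qed.

Lemma descentN y : descent y (- y) <= - p y.
Proof.
apply: ge_inf => //; exists 1 => //=.
by rewrite scale1r addNr sublinear0// mul1r sub0r.
Qed.

Hypothesis minp : forall q, sublinear q -> (forall x, q x <= p x) ->
  forall x, p x <= q x.

(** A minimal [p] is not changed by [descent], which forces [p] to be odd. *)
Lemma minimal_sublinearN y : p (- y) = - p y.
Proof.
apply/eqP; rewrite eq_le; apply/andP; split; last first.
  by have := sublinearN y sp; rewrite lerNl.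
apply: le_trans (descentN y).
exact: minp (sublinear_descent y) (descent_le y) _.
Qed.

Lemma minimal_sublinear_linear r x y : p (r *: x + y) = r * p x + p y.
Proof.
have pZ s z : p (s *: z) = s * p z.
  have [s0|/ltW s0] := leP 0 s; first exact: sublinearZ.
  rewrite -[s]opprK scaleNr minimal_sublinearN sublinearZ ?oppr_ge0//.
  by rewrite [RHS]mulNr.
rewrite -pZ; apply/eqP; rewrite eq_le sp.1/=.
have := sp.1 (r *: x + y) (- y).
by rewrite addrK minimal_sublinearN lerBrDr.
Qed.

End minimal.

(** Zorn's lemma on total functionals: the pointwise infimum of a chain is
finite because a sublinear [q] below [p] satisfies [- p (- x) <= q x]. *)
Lemma minimal_sublinear_exists p : sublinear p ->
  exists q, [/\ sublinear q, forall x, q x <= p x &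
    forall q', sublinear q' -> (forall x, q' x <= q x) ->
      forall x, q x <= q' x].
Proof.
move=> sp.
pose S := {q : V -> R | sublinear q /\ forall x, q x <= p x}.
pose ge (q q' : S) := `[< forall x, sval q' x <= sval q x >].
have [||C totC|[q [sq qp]] minq] :=
    @ZL_preorder S (exist _ p (conj sp (fun=> lexx _))) ge.
- by move=> q; apply/asboolP => x.
- move=> q1 q2 q3 /asboolP h12 /asboolP h23; apply/asboolP => x.
  exact: le_trans (h23 x) (h12 x).
- have [->|/set0P C0] := eqVneq C set0.
    by exists (exist _ p (conj sp (fun=> lexx _))).
  have lbC x : has_lbound [set sval q x | q in C].
    exists (- p (- x)) => _ [[q [sq qp]] Cq <-] /=.
    by rewrite (le_trans _ (sublinearN x sq))// lerN2.
  have sinf : sublinear (fun x => inf [set sval q x | q in C]).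
    apply: inf_sublinear => // [q q' x y Cq Cq'|q r x Cq r0]; last first.
      by exists q => //; exact: (svalP q).1.2.
    have [/asboolP h|/asboolP h] := totC _ _ Cq Cq'.
      exists q' => //; apply: le_trans ((svalP q').1.1 _ _) _.
      by rewrite lerD2r.
    exists q => //; apply: le_trans ((svalP q).1.1 _ _) _.
    by rewrite lerD2l.
  have infp x : inf [set sval q x | q in C] <= p x.
    have [q Cq] := C0; apply: le_trans ((svalP q).2 x).
    by apply: ge_inf => //; exists q.
  exists (exist (fun q => sublinear q /\ forall x, q x <= p x) _
    (conj sinf infp)) => q Cq; apply/asboolP => x /=.
  by apply: ge_inf => //; exists q.
exists q; split => // q' sq' q'q x.
have q'p z : q' z <= p z by exact: le_trans (qp z).
have /asboolP h := minq (exist _ q' (conj sq' q'p)) (introT (asboolP _) q'q).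
exact: h.
Qed.

(** A linear functional dominated by [p] is found as a minimal sublinear
functional below [descent p x0]; starting there rather than at [p] makes the
value at [x0] maximal.  This replaces the extension of partial functionals one
dimension at a time by a descent among total ones. *)
Theorem hahn_banach_sublinear p x0 : sublinear p ->
  exists u : V -> R, [/\ forall r x y, u (r *: x + y) = r * u x + u y,
    forall x, u x <= p x & u x0 = p x0].
Proof.
move=> sp.
have [u [su up minu]] := minimal_sublinear_exists (sublinear_descent sp x0).
have ulin := minimal_sublinear_linear su minu.
exists u; split => // [x|].
  exact: le_trans (up x) (descent_le sp _ _).
apply/eqP; rewrite eq_le (le_trans (up x0) (descent_le sp _ _))/=.
rewrite -lerN2 -(minimal_sublinearN su minu).
exact: le_trans (up (- x0)) (descentN sp x0).
Qed.

End hahn_banach.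

(** * Real and complex scalars *)

Section scalars.
Local Open Scope ring_scope.
Context (R : realType) (K : numFieldType) (k : RC R K).

Definition ofR : R -> K :=
  match k in RC _ K return R -> K with
  | RC_real => id
  | RC_complex => real_complex R
  end.

Lemma ofRD r s : ofR (r + s) = ofR r + ofR s.
Proof. by rewrite /ofR; case: K / k => //=; rewrite rmorphD. Qed.

Lemma ofRM r s : ofR (r * s) = ofR r * ofR s.
Proof. by rewrite /ofR; case: K / k => //=; rewrite rmorphM. Qed.

Lemma ofR1 : ofR 1 = 1.
Proof. by rewrite /ofR; case: K / k. Qed.

Lemma ofR0 : ofR 0 = 0.
Proof. by rewrite /ofR; case: K / k. Qed.

Lemma ofR_nat n : ofR n%:R = n%:R.
Proof. by rewrite /ofR; case: K / k => //=; rewrite rmorph_nat. Qed.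

Lemma ler_ofR r s : (ofR r <= ofR s) = (r <= s).
Proof. by rewrite /ofR; case: K / k => //=; rewrite lecR. Qed.

Lemma ltr_ofR r s : (ofR r < ofR s) = (r < s).
Proof. by rewrite /ofR; case: K / k => //=; rewrite ltcR. Qed.

Lemma re_ofR r : re k (ofR r) = r.
Proof. by rewrite /ofR; case: K / k. Qed.

Lemma re_ofRM r z : re k (ofR r * z) = r * re k z.
Proof.
by rewrite /ofR; case: K / k z => //= -[a b] /=; rewrite mul0r subr0.
Qed.

Lemma im_ofRM r z : im k (ofR r * z) = r * im k z.
Proof.
by rewrite /ofR; case: K / k z => [z|[a b]] /=; rewrite ?mulr0// mul0r addr0.
Qed.

Lemma reD a b : re k (a + b) = re k a + re k b.
Proof. by case: K / k a b => //= -[? ?] [? ?]. Qed.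

Lemma imD a b : im k (a + b) = im k a + im k b.
Proof. by case: K / k a b => /= [? ?|[? ?] [? ?] //]; rewrite addr0. Qed.

Lemma reN a : re k (- a) = - re k a.
Proof. by case: K / k a => //= -[? ?]. Qed.

Lemma ofR_re a : 0 <= a -> ofR (re k a) = a.
Proof. by rewrite /ofR; case: K / k a => //= a /ger0_real/RRe_real. Qed.

Lemma abs_re a : `|re k a| <= re k `|a|.
Proof.
by rewrite -ler_ofR ofR_re// /ofR; case: K / k a => //= a; exact: normc_ge_Re.
Qed.

Lemma abs_im a : `|im k a| <= re k `|a|.
Proof.
rewrite -ler_ofR ofR_re// /ofR; case: K / k a => /= [a|a].
  by rewrite normr0.
rewrite normc_def lecR -sqrtr_sqr ler_wsqrtr // lerDr sqr_ge0//.
Qed.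

Lemma abs_ofR r : `|ofR r| = ofR `|r|.
Proof.
by rewrite /ofR; case: K / k => //=; rewrite normc_def expr0n addr0 sqrtr_sqr.
Qed.

Lemma norm_le_re_im a : re k `|a| <= `|re k a| + `|im k a|.
Proof.
rewrite -ler_ofR ofR_re// ofRD -!abs_ofR /ofR.
case: K / k a => [a|a] /=; first by rewrite normr0 addr0.
rewrite {1}[a]complexE; apply: le_trans (ler_normD _ _) _.
by rewrite normrM (normc_def 'i%C)/= expr0n /= add0r expr1n sqrtr1 mul1r.
Qed.

End scalars.

(** * The real-valued norm *)

Section rnorm.
Local Open Scope ring_scope.
Context (R : realType) (K : numFieldType) (k : RC R K) (X : normedModType K).
Local Notation N := (@rnorm R K k X).

Lemma ofR_rnorm x : ofR k (N x) = `|x|.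
Proof. by rewrite ofR_re. Qed.

Lemma rnorm_ge0 x : 0 <= N x.
Proof. by rewrite -(ler_ofR k) ofR0 ofR_rnorm. Qed.

Lemma rnorm0 : N 0 = 0.
Proof. by rewrite /rnorm normr0 -(ofR0 k) re_ofR. Qed.

Lemma rnorm0_eq0 x : N x = 0 -> x = 0.
Proof. by move=> x0; apply/eqP; rewrite -normr_eq0 -ofR_rnorm x0 ofR0. Qed.

Lemma rnormD x y : N (x + y) <= N x + N y.
Proof. by rewrite -(ler_ofR k) ofRD !ofR_rnorm ler_normD. Qed.

Lemma rnormN x : N (- x) = N x.
Proof. by rewrite /rnorm normrN. Qed.

Lemma rnormB x y : N (x - y) = N (y - x).
Proof. by rewrite -rnormN opprB. Qed.

Lemma rnormZ a x : N (a *: x) = re k `|a| * N x.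
Proof. by rewrite /rnorm normrZ -[in LHS](ofR_re k (normr_ge0 a)) re_ofRM. Qed.

Lemma ler_dist_rnorm x y : `|N x - N y| <= N (x - y).
Proof.
have h u v : N u - N v <= N (u - v).
  by rewrite lerBlDr -[in leLHS](subrK v u) rnormD.
by rewrite ler_norml h lerNl opprB rnormB h.
Qed.

Lemma cvg_rnormP (s : nat -> X) (x : X) :
  s @ \oo --> x <-> (fun n => N (s n - x)) @ \oo --> (0 : R).
Proof.
split.
- move=> /cvgr_dist_lt h; apply/cvgrPdist_lt => e e0.
  have := h (ofR k e); rewrite -(ofR0 k) ltr_ofR => /(_ e0).
  apply: filterS => n; rewrite -ofR_rnorm ltr_ofR sub0r normrN.
  by rewrite ger0_norm ?rnorm_ge0// rnormB.
- move=> /cvgr_dist_lt h; apply/cvgrPdist_lt => e e0.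
  have e0' := ofR_re k (ltW e0).
  have := h (re k e); rewrite -(ltr_ofR k) ofR0 e0' => /(_ e0).
  apply: filterS => n; rewrite sub0r normrN ger0_norm ?rnorm_ge0// rnormB.
  by rewrite -(ltr_ofR k) ofR_rnorm e0'.
Qed.

End rnorm.

(** * Norming functionals *)

Section real_functionals.
Local Open Scope ring_scope.
Context (R : realType) (K : numFieldType) (k : RC R K).

(** A separate name for [X], to carry its structure of real vector space without
interfering with the scalar multiplication by [K]. *)
Definition real_restriction (k : RC R K) (X : lmodType K) : Type := X.

Section real_module.
Variable X : lmodType K.

HB.instance Definition _ := GRing.Zmodule.copy (real_restriction k X) X.

Definition real_scale (r : R) (x : real_restriction k X) :
  real_restriction k X := ofR k r *: (x : X).

Let real_scaleA a b v : real_scale a (real_scale b v) = real_scale (a * b) v.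
Proof. by rewrite /real_scale scalerA ofRM. Qed.

Let real_scale1 : left_id 1 real_scale.
Proof. by move=> v; rewrite /real_scale ofR1 scale1r. Qed.

Let real_scaleDr : right_distributive real_scale +%R.
Proof. by move=> a u v; rewrite /real_scale scalerDr. Qed.

Let real_scaleDl v : {morph real_scale^~ v : a b / a + b}.
Proof. by move=> a b; rewrite /real_scale ofRD scalerDl. Qed.

HB.instance Definition _ := GRing.Zmodule_isLmodule.Build R
  (real_restriction k X) real_scaleA real_scale1 real_scaleDr real_scaleDl.

End real_module.

Lemma real_norming_functional (X : normedModType K) (x0 : X) :
  exists u : X -> R, [/\ forall r x y, u (ofR k r *: x + y) = r * u x + u y,
    forall x, `|u x| <= rnorm k x & u x0 = rnorm k x0].
Proof.
have [|u [ulin uN ux0]] :=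
  @hahn_banach_sublinear R (real_restriction k X) (@rnorm R K k X) x0.
  split=> [x y|r x r0]; first exact: rnormD.
  by rewrite rnormZ abs_ofR re_ofR ger0_norm.
exists u; split => // x; rewrite ler_norml uN lerNl andbT.
have u0 : u 0 = 0.
  have /eqP := ulin 1 0 0.
  by rewrite scaler0 addr0 mul1r -[X in X == _]add0r (inj_eq (addIr _)) => /eqP.
have := ulin (-1) x 0; rewrite scaleN1r !addr0 u0 addr0 mulN1r => <-.
by rewrite -[leRHS]rnormN uN.
Qed.

Lemma bounded_functional (X : normedModType K) (f : X -> K^o) (C : R) :
  linear f -> (forall x, re k `|f x| <= C * rnorm k x) ->
  exists2 xs : {linear X -> K^o}, continuous xs & xs =1 f.
Proof.
move=> flin fC.
pose F := GRing.isLinear.Build K X K^o _ f flin.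
pose xs : {linear X -> K^o} := HB.pack f F.
exists xs => //; apply: bounded_linear_continuous; apply/linear_boundedP.
near=> r => x; apply: (@le_trans _ _ (ofR k C * `|x|)).
  by rewrite -(ofR_rnorm k x) -ofRM -(ofR_re k (normr_ge0 (xs x))) ler_ofR fC.
apply: ler_wpM2r => //; near: r; apply: nbhs_pinfty_ge.
rewrite /ofR; case: K / k => /=; first exact: num_real.
by apply/complex_realP; exists C.
Unshelve. all: by end_near. Qed.

End real_functionals.

Section norming_functional.
Local Open Scope ring_scope.

(** In the complex case, a real-linear [u] is the real part of the
complex-linear functional [x |-> u x - i u (i x)]. *)
Lemma norming_functional (R : realType) (K : numFieldType) (k : RC R K)
    (X : normedModType K) (x0 : X) :
  exists2 xs : {linear X -> K^o}, continuous xs & re k (xs x0) = rnorm k x0.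
Proof.
have [u [ulin uN ux0]] := real_norming_functional k x0.
case: K / k X x0 u ulin uN ux0 => X x0 u ulin uN ux0.
  have [|x|xs cxs xsE] := @bounded_functional _ _ (RC_real R) X u 1.
  - by move=> r x y; exact: ulin.
  - by rewrite mul1r uN.
  by exists xs => //; rewrite xsE; exact: ux0.
pose f (x : X) : R[i]^o := Complex (u x) (- u ('i%C *: x)).
have [|x|xs cxs xsE] := @bounded_functional _ _ (RC_complex R) X f 2.
- move=> [a b] x y; rewrite /f.
  have uE z : u ((a +i* b)%C *: x + z) = a * u x + (b * u ('i%C *: x) + u z).
    rewrite -!ulin; congr u; rewrite !scalerA addrA -scalerDl.
    by rewrite {1}[(a +i* b)%C]complexE /= (mulrC 'i%C).
  rewrite scalerDr scalerA (mulrC 'i%C) -scalerA.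
  have uiE z : u ((a +i* b)%C *: ('i%C *: x) + z) =
      a * u ('i%C *: x) + (- b * u x + u z).
    rewrite -!ulin; congr u; rewrite !scalerA addrA -scalerDl.
    congr (_ *: _ + _); rewrite {1}[(a +i* b)%C]complexE /=.
    by rewrite mulrDl mulrAC -expr2 sqr_i mulN1r rmorphN.
  rewrite uE uiE; apply/eqP; rewrite eq_complex /=; apply/andP.
  by split; apply/eqP; ring.
- rewrite (le_trans (norm_le_re_im _ _))// /f /= normrN mulr2n mulrDl mul1r.
  rewrite lerD// (le_trans (uN _))// rnormZ.
  by rewrite (normc_def 'i%C) /= expr0n /= add0r expr1n sqrtr1 mul1r.
by exists xs => //; rewrite xsE; exact: ux0.
Qed.

End norming_functional.

(** * Pointwise limits of finitely valued functions *)

Section finitely_valued.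
Context d (T : measurableType d).

Definition finitely_valued (Y : Type) (s : T -> Y) :=
  finite_set (range s) /\ forall y, measurable (s @^-1` [set y]).

(** Only finitely many values matter, so [A] can be arbitrary; this is what
makes any function of one or two finitely valued functions again finitely
valued. *)
Lemma finitely_valued_preimage (Y : Type) (s : T -> Y) (A : set Y) :
  finitely_valued s -> measurable (s @^-1` A).
Proof.
move=> [sfin ms].
have -> : s @^-1` A = \bigcup_(y in A `&` range s) s @^-1` [set y].
  apply/seteqP; split=> [t As|t [y [Ay _]] /= -> //].
  by exists (s t) => //; split => //; exists t.
apply: fin_bigcup_measurable => //.
by apply: sub_finite_set sfin; exact: subIsetr.
Qed.

Lemma finitely_valued_comp (Y Z : Type) (g : Y -> Z) (s : T -> Y) :
  finitely_valued s -> finitely_valued (g \o s).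
Proof.
move=> fs; split; last first.
  by move=> z; rewrite comp_preimage; exact: finitely_valued_preimage.
by rewrite -(image_comp s g); apply: finite_image; exact: fs.1.
Qed.

Lemma finitely_valued_pair (Y Z : Type) (s : T -> Y) (s' : T -> Z) :
  finitely_valued s -> finitely_valued s' ->
  finitely_valued (fun t => (s t, s' t)).
Proof.
move=> fs fs'; split.
  apply: (@sub_finite_set _ _ (range s `*` range s')).
    by move=> _ [t _ <-]; split; exists t.
  by apply: finite_setX; [exact: fs.1|exact: fs'.1].
move=> [y z]; rewrite (_ : _ @^-1` _ = s @^-1` [set y] `&` s' @^-1` [set z]).
  by apply: measurableI; [exact: fs.2|exact: fs'.2].
by apply/seteqP; split=> t /= [-> ->].
Qed.

Lemma finitely_valued_cst (Y : Type) (y : Y) : finitely_valued (cst y : T -> Y).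
Proof.
split; first by apply: (sub_finite_set _ (finite_set1 y)) => _ [t _ <-].
by move=> z; rewrite preimage_cst; case: ifP.
Qed.

Lemma finitely_valued_mem (B : set T) :
  measurable B -> finitely_valued (fun t => t \in B).
Proof.
move=> mB; split; first exact: finite_finset.
move=> b; rewrite (_ : _ @^-1` _ = if b then B else ~` B).
  by case: b => //; exact: measurableC.
apply/seteqP; case: b; split => t /=.
- by move/set_mem.
- by move/mem_set.
- by move=> /negbT; rewrite notin_setE.
- by move=> Bt; apply/negbTE; rewrite notin_setE.
Qed.

Lemma finitely_valued_measurable (R : realType) (s : T -> R) :
  finitely_valued s -> measurable_fun setT s.
Proof. by move=> fs _ A mA; rewrite setTI; exact: finitely_valued_preimage. Qed.

End finitely_valued.

Section pointwise_limits.
Context d (T : measurableType d) (R : realType) (K : numFieldType) (k : RC R K).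
Variable X : normedModType K.
Local Notation N := (@rnorm R K k X).

Definition pointwise_measurable (f : T -> X) :=
  exists s : nat -> T -> X, (forall n, finitely_valued (s n)) /\
    forall t, (fun n => s n t) @ \oo --> f t.

Lemma finitely_valued_pointwise f :
  finitely_valued f -> pointwise_measurable f.
Proof. by move=> ff; exists (fun=> f); split => // t; exact: cvg_cst. Qed.

Lemma pointwise_measurableD f g : pointwise_measurable f ->
  pointwise_measurable g -> pointwise_measurable (f \+ g)%R.
Proof.
move=> [s [fs sf]] [s' [fs' sg]]; exists (fun n => s n \+ s' n)%R.
split=> [n|t].
  have := finitely_valued_pair (fs n) (fs' n).
  exact: (finitely_valued_comp (fun y => y.1 + y.2)%R).
exact: cvgD.
Qed.

Lemma pointwise_measurableN f : pointwise_measurable f ->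
  pointwise_measurable (fun t => - f t)%R.
Proof.
move=> [s [fs sf]]; exists (fun n t => - s n t)%R; split=> [n|t].
  exact: (finitely_valued_comp (fun y => - y)%R).
exact: cvgN.
Qed.

Lemma pointwise_measurableB f g : pointwise_measurable f ->
  pointwise_measurable g -> pointwise_measurable (f \- g)%R.
Proof.
move=> pf pg; apply: pointwise_measurableD => //.
exact: pointwise_measurableN.
Qed.

(** By continuity, [phi \o f] is the pointwise limit of the real functions
[phi \o s n], where the [s n] are finitely valued and converge to [f]. *)
Lemma pointwise_measurable_lipschitz (phi : X -> R) (C : R) f :
  (forall x y, `|phi x - phi y| <= C * N (x - y))%R ->
  pointwise_measurable f -> measurable_fun setT (phi \o f).
Proof.
move=> phiC [s [fs sf]].
apply: (@measurable_fun_cvg _ _ _ setT (fun n => phi \o s n)).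
  move=> n; apply: finitely_valued_measurable; exact: finitely_valued_comp.
move=> t _; apply/cvgrPdist_le => e e0.
have : (fun n => C * N (s n t - f t))%R @ \oo --> (C * 0)%R.
  by apply: cvgM; [exact: cvg_cst|exact: (cvg_rnormP k _ _).1].
rewrite mulr0 => /cvgr0Pnorm_le /(_ _ e0); apply: filterS => n.
move=> h; rewrite distrC (le_trans (phiC _ _))// (le_trans _ h)//.
exact: ler_norm.
Qed.

Lemma measurable_rnorm f : pointwise_measurable f ->
  measurable_fun setT (fun t => N (f t)).
Proof.
apply: (@pointwise_measurable_lipschitz N 1) => x y.
by rewrite mul1r ler_dist_rnorm.
Qed.

Definition real_functional (C : R) (phi : X -> R) :=
  (forall r x y, phi (ofR k r *: x + y) = r * phi x + phi y)%R /\
  (forall x, `|phi x| <= C * N x)%R.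

Section real_functional_theory.
Variables (C : R) (phi : X -> R).
Hypothesis hphi : real_functional C phi.

Lemma real_functionalD x y : (phi (x + y) = phi x + phi y)%R.
Proof. by have := hphi.1 1%R x y; rewrite ofR1 scale1r mul1r. Qed.

Lemma real_functional0 : (phi 0 = 0)%R.
Proof.
by apply/eqP; rewrite -normr_le0 (le_trans (hphi.2 _))// rnorm0 mulr0.
Qed.

Lemma real_functionalZ r x : (phi (ofR k r *: x) = r * phi x)%R.
Proof. by have := hphi.1 r x 0%R; rewrite real_functional0 !addr0. Qed.

Lemma real_functionalB x y : (phi (x - y) = phi x - phi y)%R.
Proof.
have : phi (x - y + y)%R = (phi (x - y) + phi y)%R := real_functionalD _ _.
by rewrite subrK => ->; rewrite addrK.
Qed.

Lemma measurable_real_functional f :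
  pointwise_measurable f -> measurable_fun setT (phi \o f).
Proof.
apply: (@pointwise_measurable_lipschitz phi C) => x y.
by rewrite -real_functionalB; exact: hphi.2.
Qed.

End real_functional_theory.

End pointwise_limits.

(** * Integrals of vector-valued functions *)

Section bochner_integral.
Context d (T : measurableType d) (R : realType).
Variable mu : {measure set T -> \bar R}.
Context (K : numFieldType) (k : RC R K) (X : normedModType K).
Local Notation N := (@rnorm R K k X).

Section on_a_set.
Variable D : set T.
Hypothesis mD : measurable D.

Definition norm_integrable (f : T -> X) :=
  pointwise_measurable f /\ \int[mu]_(t in D) (N (f t))%:E < +oo.

Lemma norm_integrable_rnorm f : norm_integrable f ->
  mu.-integrable D (EFin \o (N \o f)).
Proof.
move=> [pf fi]; apply/integrableP; split.
  by apply/measurable_EFinP; apply: measurable_funTS; exact: measurable_rnorm.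
rewrite (eq_integral (fun t => (N (f t))%:E))// => t _ /=.
by rewrite ger0_norm// rnorm_ge0.
Qed.

Lemma norm_integrable_functional C phi f : real_functional k C phi ->
  norm_integrable f -> mu.-integrable D (EFin \o (phi \o f)).
Proof.
move=> hphi fi; have iC : mu.-integrable D (EFin \o (fun t => C * N (f t))%R).
  exact: integrableZl (norm_integrable_rnorm fi).
apply: le_integrable iC => //.
  apply/measurable_EFinP; apply: measurable_funTS.
  exact: (measurable_real_functional hphi fi.1).
by move=> t _ /=; rewrite lee_fin (le_trans (hphi.2 _))// ler_norm.
Qed.

Lemma norm_integrableD f g : norm_integrable f -> norm_integrable g ->
  norm_integrable (f \+ g)%R.
Proof.
move=> fi gi; split; first exact: pointwise_measurableD fi.1 gi.1.
have mf := measurable_funTS (measurable_rnorm k fi.1).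
have mg := measurable_funTS (measurable_rnorm k gi.1).
apply: (@le_lt_trans _ _
  (\int[mu]_(t in D) ((N (f t))%:E + (N (g t))%:E))).
  apply: ge0_le_integral => //.
  - by move=> t _; rewrite lee_fin rnorm_ge0.
  - apply/measurable_EFinP; apply: measurable_funTS.
    exact: measurable_rnorm (pointwise_measurableD fi.1 gi.1).
  - by apply: emeasurable_funD; apply/measurable_EFinP.
  - by move=> t _; rewrite -EFinD lee_fin rnormD.
rewrite ge0_integralD//; try by move=> t _; rewrite lee_fin rnorm_ge0.
- by rewrite lte_add_pinfty ?fi.2 ?gi.2.
- exact/measurable_EFinP.
- exact/measurable_EFinP.
Qed.

Lemma norm_integrableN f : norm_integrable f ->
  norm_integrable (fun t => - f t)%R.
Proof.
move=> [pf fi]; split; first exact: pointwise_measurableN.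
by under eq_integral do rewrite rnormN.
Qed.

Lemma norm_integrableB f g : norm_integrable f -> norm_integrable g ->
  norm_integrable (f \- g)%R.
Proof.
by move=> fi gi; apply: norm_integrableD => //; exact: norm_integrableN.
Qed.

Lemma dist_integral_functional C phi f g : real_functional k C phi ->
  (0 <= C)%R -> norm_integrable f -> norm_integrable g ->
  `| \int[mu]_(t in D) (phi (f t))%:E - \int[mu]_(t in D) (phi (g t))%:E | <=
  C%:E * \int[mu]_(t in D) (N (f t - g t))%:E.
Proof.
move=> hphi C0 fi gi.
have fgi := norm_integrableB fi gi.
have ip := norm_integrable_functional hphi.
rewrite -integralB_EFin//; [|exact: ip fi|exact: ip gi].
have mfg := measurable_funTS (measurable_rnorm k fgi.1).
under eq_integral do rewrite -EFinB -(real_functionalB hphi).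
apply: le_trans (le_abse_integral _ mD _) _.
  by have /integrableP[] := ip _ fgi.
rewrite -ge0_integralZl_EFin//; last 2 first.
  by move=> t _; rewrite lee_fin rnorm_ge0.
  exact/measurable_EFinP.
apply: ge0_le_integral => //.
- by apply: measurableT_comp => //; have /integrableP[] := ip _ fgi.
- by apply: measurable_funeM; exact/measurable_EFinP.
- by move=> t _; rewrite abse_EFin lee_fin; exact: hphi.2.
Qed.

(** The Bochner integral of [f] over [D] is [x].  Testing with all bounded
real-linear functionals instead of the [K]-linear ones allows the same
treatment of both scalar fields; since real and imaginary parts of the latter
are among the former, the Pettis integral is covered. *)
Definition has_integral (f : T -> X) (x : X) :=
  norm_integrable f /\ forall C phi, real_functional k C phi ->
    \int[mu]_(t in D) (phi (f t))%:E = (phi x)%:E.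

(** The estimate is that of [dist_integral_functional], applied to a functional
of norm at most [1] that attains the norm at [x - y]. *)
Lemma rnorm_dist_has_integral f g x y : has_integral f x -> has_integral g y ->
  (N (x - y))%:E <= \int[mu]_(t in D) (N (f t - g t))%:E.
Proof.
move=> [fi fx] [gi gy].
have [u [ulin uN uxy]] := real_norming_functional k (x - y)%R.
have hu : real_functional k 1%R u by split => // z; rewrite mul1r.
have := dist_integral_functional hu ler01 fi gi.
rewrite (fx _ _ hu) (gy _ _ hu) mul1e; apply: le_trans.
by rewrite -EFinB abse_EFin lee_fin -(real_functionalB hu) uxy ler_norm.
Qed.

Lemma has_integralD f g x y : has_integral f x -> has_integral g y ->
  has_integral (f \+ g)%R (x + y)%R.
Proof.
move=> [fi fx] [gi gy]; split; first exact: norm_integrableD.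
move=> C phi hphi; have ip := norm_integrable_functional hphi.
under eq_integral do rewrite (real_functionalD hphi) EFinD.
by rewrite integralD_EFin//= ?(fx _ _ hphi) ?(gy _ _ hphi)
  ?(real_functionalD hphi)//; [exact: ip fi|exact: ip gi].
Qed.

Lemma has_integral0 : has_integral (cst 0%R) 0%R.
Proof.
split; first split.
- by apply: finitely_valued_pointwise; exact: finitely_valued_cst.
- by rewrite integral0_eq// => t _; rewrite rnorm0.
- move=> C phi hphi.
  by rewrite integral0_eq ?(real_functional0 hphi)// => t _;
    rewrite (real_functional0 hphi).
Qed.

Lemma has_integral_chi (B : set T) (y : X) : measurable B ->
  mu (B `&` D) < +oo ->
  has_integral (chi B (cst y)) (ofR k (fine (mu (B `&` D))) *: y)%R.
Proof.
move=> mB muB.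
have iB : \int[mu]_(t in D) (\1_B t)%:E = (fine (mu (B `&` D)))%:E.
  by rewrite integral_indic// fineK// ge0_fin_numE.
have chiE t : chi B (cst y) t = (ofR k (\1_B t) *: y)%R.
  by rewrite /chi !indicE ofR_nat.
have iBZ r : \int[mu]_(t in D) (\1_B t * r)%:E =
    (fine (mu (B `&` D)) * r)%:E.
  under eq_integral do rewrite mulrC EFinM.
  rewrite integralZl//.
    by rewrite iB -EFinM mulrC.
  apply/integrableP; split; first exact/measurable_EFinP/measurable_indic.
  rewrite (eq_integral (fun t => (\1_B t)%:E)) ?iB ?ltry// => t _ /=.
  by rewrite ger0_norm.
split; first split.
- apply: finitely_valued_pointwise.
  exact: (finitely_valued_comp (fun b : bool => (b%:R *: y)%R)
    (finitely_valued_mem mB)).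
- under eq_integral do rewrite chiE rnormZ abs_ofR re_ofR ger0_norm//.
  by rewrite iBZ ltry.
- move=> C phi hphi.
  under eq_integral do rewrite chiE (real_functionalZ hphi).
  by rewrite iBZ (real_functionalZ hphi).
Qed.

(** A simple function is the sum over its nonzero values [y] of [y] times the
indicator of the level set of [y]; these level sets have finite measure. *)
Lemma simple_has_integral s : simple_finite_support mu s ->
  exists x, has_integral s x.
Proof.
move=> [sfin ms mus].
have fs : finitely_valued s by [].
have [r rE] := (finite_seqP _).1 sfin.
have {}rE t : s t \in undup r.
  by have : range s (s t) by [exists t]; rewrite rE mem_undup.
pose c y : X := (ofR k (fine (mu (s @^-1` [set y] `&` D))) *: y)%R.
have hc y : y != 0%R -> has_integral (chi (s @^-1` [set y]) (cst y)) (c y).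
  move=> y0; apply: has_integral_chi => //.
  apply: le_lt_trans mus; apply: le_measure; rewrite ?inE.
  - exact: measurableI.
  - exact: (finitely_valued_preimage [set x | x != 0%R]).
  - by move=> t [/= -> _].
exists (\sum_(y <- undup r | y != 0%R) c y)%R.
have -> : s = (fun t => \sum_(y <- undup r | y != 0%R)
    chi (s @^-1` [set y]) (cst y) t)%R.
  apply/funext => t; have chi0 y : y != s t ->
      chi (s @^-1` [set y]) (cst y) t = 0%R.
    move=> yst; rewrite /chi indicE memNset ?scale0r//= => e.
    by rewrite e eqxx in yst.
  have [st0|st0] := eqVneq (s t) 0%R.
    by rewrite big1// => y y0; rewrite chi0// st0.
  rewrite -big_filter (bigD1_seq (s t))
    ?filter_uniq ?undup_uniq ?mem_filter ?st0//=.
  rewrite big1 ?addr0; last by move=> y; exact: chi0.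
  by rewrite /chi indicE mem_set//= scale1r.
elim: (undup r) => [|y l ih].
  by under eq_fun do rewrite big_nil; rewrite big_nil; exact: has_integral0.
under eq_fun do rewrite big_cons; rewrite big_cons.
by case: ifPn => // y0; exact: has_integralD (hc _ y0) ih.
Qed.

End on_a_set.
End bochner_integral.

(** * Approximation by simple functions and existence of the integral *)

Section existence.
Context d (T : measurableType d) (R : realType).
Variable mu : {measure set T -> \bar R}.
Context (K : numFieldType) (k : RC R K).

Definition simple_limit (X : normedModType K) (f : T -> X) :=
  exists s : nat -> T -> X, (forall n, simple_finite_support mu (s n)) /\
    forall t, (fun n => s n t) @ \oo --> f t.

Lemma simple_finite_supportW (X : normedModType K) (s : T -> X) :
  simple_finite_support mu s -> finitely_valued s.
Proof. by case. Qed.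

Lemma simple_limit_pointwise (X : normedModType K) (f : T -> X) :
  simple_limit f -> pointwise_measurable f.
Proof.
by move=> [s [fs sf]]; exists s; split => // n; exact: simple_finite_supportW.
Qed.

Section approximation.
Variables (X : normedModType K) (D : set T).
Hypothesis mD : measurable D.
Local Notation N := (@rnorm R K k X).

Lemma simple_norm_integrable (s : T -> X) :
  simple_finite_support mu s -> norm_integrable mu k D s.
Proof. by move=> /(simple_has_integral k mD)[x []]. Qed.

(** The approximating functions [s n] are cut off where their norm exceeds twice
that of [f].  This keeps them convergent to [f] and makes [3 * N (f w)]
dominate the error, so that dominated convergence applies. *)
Lemma simple_approximation (f : T -> X) : simple_limit f ->
  norm_integrable mu k D f ->
  exists t : nat -> T -> X, exists a : nat -> R,
    [/\ forall n, simple_finite_support mu (t n),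
        forall n, \int[mu]_(w in D) (N (f w - t n w))%:E = (a n)%:E &
        a @ \oo --> (0 : R)%R].
Proof.
move=> [s [ss sf]] fi.
have mf := measurable_rnorm k fi.1.
pose E n := [set w | (N (s n w) <= 2 * N (f w))%R].
have mE n : measurable (E n).
  rewrite -[E n]setTI; apply: measurable_fun_le => //.
    apply: measurable_rnorm; apply: finitely_valued_pointwise.
    exact: simple_finite_supportW.
  exact: measurable_funM.
pose t n w : X := if w \in E n then s n w else 0%R.
have ft n : finitely_valued (t n).
  have := finitely_valued_pair (simple_finite_supportW (ss n))
    (finitely_valued_mem (mE n)).
  exact: (finitely_valued_comp (fun y : X * bool => if y.2 then y.1 else 0%R)).
have ts n : simple_finite_support mu (t n).
  have [tfin mt] := ft n; split => //; have [_ _] := ss n.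
  apply: le_lt_trans; apply: le_measure; rewrite ?inE.
  - exact: (finitely_valued_preimage [set x : X | x != 0%R] (ft n)).
  - exact: (finitely_valued_preimage [set x : X | x != 0%R]
      (simple_finite_supportW (ss n))).
  - by move=> w /=; rewrite /t; case: ifP => //; rewrite eqxx.
have ti n := simple_norm_integrable (ts n).
have tf w : (fun n => N (f w - t n w)%R) @ \oo --> (0 : R)%R.
  (* Where [f] vanishes the cut-off leaves only the value [0], whereas elsewhere
     it is eventually inactive. *)
  have [fw0|fw0] := eqVneq (f w) 0%R.
    rewrite (_ : (fun n => _) = cst 0%R); first exact: cvg_cst.
    apply/funext => n; rewrite /t fw0 sub0r rnormN.
    case: ifPn => [|_]; last exact: rnorm0.
    rewrite inE /E /= fw0 rnorm0 mulr0 => h.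
    by apply/eqP; rewrite eq_le h rnorm_ge0.
  have Nf0 : (0 < N (f w))%R.
    rewrite lt_def rnorm_ge0 andbT; apply: contra_neq fw0; exact: rnorm0_eq0.
  have h := (cvg_rnormP k _ _).1 (sf w).
  apply: cvg_trans (h); apply: near_eq_cvg.
  move/cvgr0Pnorm_le: (h) => /(_ _ Nf0); apply: filterS => n.
  rewrite ger0_norm ?rnorm_ge0// => hn.
  have Enw : E n w.
    rewrite /E /= -[s n w](subrK (f w)) (le_trans (rnormD _ _ _))//.
    by rewrite mulr2n mulrDl mul1r lerD2r.
  by rewrite /t (mem_set Enw) rnormB.
pose a n := fine (\int[mu]_(w in D) (N (f w - t n w))%:E).
have aE n : \int[mu]_(w in D) (N (f w - t n w))%:E = (a n)%:E.
  have [_ h] := norm_integrableB mD fi (ti n).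
  rewrite fineK// ge0_fin_numE//; apply: integral_ge0 => w _.
  by rewrite lee_fin rnorm_ge0.
exists t, a; split => //.
have iN := norm_integrable_rnorm fi.
have i3 : mu.-integrable D (EFin \o (fun w => 3 * N (f w))%R).
  exact: (integrableZl mD (3%R : R) iN).
have mt n : measurable_fun D (fun w => (N (f w - t n w))%:E).
  apply/measurable_EFinP; apply: measurable_funTS.
  exact: measurable_rnorm (pointwise_measurableB fi.1 (ti n).1).
have [|||_ _ cv] := @dominated_convergence _ _ _ mu D mD
  (fun n w => (N (f w - t n w))%:E) (cst 0) (fun w => (3 * N (f w))%:E)
  mt _ _ i3.
- exact: measurable_cst.
- by apply/aeW => w _; apply: cvg_EFin; [exact: nearW|exact: tf].
- apply/aeW => w n _; rewrite abse_EFin lee_fin ger0_norm ?rnorm_ge0//.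
  have h : (N (t n w) <= 2 * N (f w))%R.
    rewrite /t; case: ifPn => [/set_mem //|_].
    by rewrite rnorm0 mulr_ge0 ?rnorm_ge0.
  rewrite (le_trans (rnormD _ _ _))// rnormN.
  have -> : (3 * N (f w) = N (f w) + 2 * N (f w))%R by ring.
  by rewrite lerD2l.
by rewrite integral_cst// mul0e in cv; apply: fine_cvg cv.
Qed.

End approximation.
End existence.

Section pettis.
Context d (T : measurableType d) (R : realType).
Variable mu : {measure set T -> \bar R}.
Context (K : numFieldType) (k : RC R K).

Lemma squeeze_dist (u b : nat -> R) (l C : R) :
  (forall n, `|l - u n| <= C * b n)%R -> b @ \oo --> (0 : R)%R ->
  u @ \oo --> l.
Proof.
move=> ub b0; apply/cvgrPdist_le => e e0.
have : (fun n => C * b n)%R @ \oo --> (C * 0)%R.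
  by apply: cvgM => //; exact: cvg_cst.
rewrite mulr0 => /cvgr0Pnorm_le /(_ _ e0); apply: filterS => n h.
by rewrite (le_trans (ub n))// (le_trans _ h)// ler_norm.
Qed.

Section on_a_set.
Variable D : set T.
Hypothesis mD : measurable D.

(** The integrals of the simple approximations form a Cauchy sequence by
[rnorm_dist_has_integral], and a bounded functional commutes with both
limits. *)
Lemma has_integral_exists (X : completeNormedModType K) (f : T -> X) :
  simple_limit mu f -> norm_integrable mu k D f ->
  exists x, has_integral mu k D f x.
Proof.
move=> slf fi; have [t [a [ts aE a0]]] := simple_approximation mD slf fi.
have /choice[x_ hx] n := simple_has_integral k mD (ts n).
have dx n m : (rnorm k (x_ n - x_ m) <= a n + a m)%R.
  have mN j : measurable_fun D (fun w => (rnorm k (f w - t j w)%R)%:E).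
    apply/measurable_EFinP; apply: measurable_funTS.
    exact: measurable_rnorm (pointwise_measurableB fi.1 (hx j).1.1).
  rewrite -lee_fin EFinD -!aE -ge0_integralD//;
    try by move=> w _; rewrite lee_fin rnorm_ge0.
  apply: le_trans (rnorm_dist_has_integral mD (hx n) (hx m)) _.
  apply: ge0_le_integral => //.
  - by move=> w _; rewrite lee_fin rnorm_ge0.
  - apply/measurable_EFinP; apply: measurable_funTS.
    exact: measurable_rnorm (pointwise_measurableB (hx n).1.1 (hx m).1.1).
  - exact: emeasurable_funD.
  - move=> w _; rewrite -EFinD lee_fin (rnormB k (f w) (t n w)).
    by apply: le_trans (rnormD _ _ _); rewrite addrA subrK.
have /cvg_ex[x xx] : cvg (x_ @ \oo).
  apply/cauchy_cvgP/cauchy_exP => e e0.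
  pose r := (re k e / 2)%R.
  have er : ofR k (r + r)%R = e by rewrite -splitr ofR_re// ltW.
  have r0 : (0 < r)%R.
    by rewrite divr_gt0// -(ltr_ofR k) ofR_re ?ltW// ofR0.
  move/cvgr0Pnorm_lt: a0 => /(_ _ r0)[M _ hM].
  exists (x_ M); exists M => // n /= Mn.
  rewrite -ball_normE /= -(ofR_rnorm k) -er ltr_ofR.
  apply: le_lt_trans (dx _ _) _; apply: ltrD.
    exact: le_lt_trans (ler_norm _) (hM M (leqnn M)).
  exact: le_lt_trans (ler_norm _) (hM n Mn).
exists x; split => // C phi hphi.
pose I := fine (\int[mu]_(w in D) (phi (f w))%:E).
have IE : \int[mu]_(w in D) (phi (f w))%:E = I%:E.
  rewrite fineK//.
  exact: integrable_fin_num (norm_integrable_functional mD hphi fi).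
(* On a trivial space the bound [C] of a functional may be negative. *)
have hphi' : real_functional k `|C|%R phi.
  split; first exact: hphi.1.
  move=> z; rewrite (le_trans (hphi.2 z))// ler_wpM2r ?rnorm_ge0//.
  exact: ler_norm.
rewrite IE; congr (_ %:E).
apply: (@cvg_unique _ _ (phi \o x_ @ \oo)) => //.
  apply: (@squeeze_dist _ a _ `|C|%R) => // n /=.
  have := dist_integral_functional mD hphi' (normr_ge0 C) fi (hx n).1.
  by rewrite IE ((hx n).2 _ _ hphi) aE.
apply: (@squeeze_dist _ (fun n => rnorm k (x_ n - x)%R) _ C) => [n|].
  by rewrite /= -(real_functionalB hphi) (le_trans (hphi.2 _))// rnormB.
exact: (cvg_rnormP k _ _).1.
Qed.

Lemma functional_re_im (X : normedModType K) (xs : {linear X -> K^o}) :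
  continuous xs -> exists C, real_functional k C (fun x => re k (xs x)) /\
    real_functional k C (fun x => im k (xs x)).
Proof.
move=> /linear_bounded_continuous/linear_boundedP/pinfty_ex_gt0[r r0 xsr].
have xsC x : (re k `|xs x| <= re k r * rnorm k x)%R.
  by rewrite -(ler_ofR k) ofR_re// ofRM ofR_rnorm ofR_re ?(ltW r0)//.
exists (re k r); split; split.
- by move=> a x y; rewrite linearP reD; congr (_ + _)%R; exact: re_ofRM.
- by move=> x; exact: le_trans (abs_re k _) (xsC x).
- by move=> a x y; rewrite linearP imD; congr (_ + _)%R; exact: im_ofRM.
- by move=> x; exact: le_trans (abs_im k _) (xsC x).
Qed.

(** A second candidate [y] has the same scalar integrals as [x], so the real part
of a functional that attains the norm at [y - x] is both [0] and that norm. *)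
Lemma has_integral_pettis (X : normedModType K) (f g : T -> X) (x : X) :
  has_integral mu k D f x -> g = f %[ae mu in D] ->
  pettis_integral mu k D g = x.
Proof.
move=> [fi fx] gf.
have pgx : is_pettis_integral mu k D g x.
  move=> xs /functional_re_im[C [hre him]].
  split.
    rewrite -[RHS](fx _ _ hre); apply: ae_eq_integral_gen.
    by apply: filterS gf => w h Dw; rewrite h.
  rewrite -[RHS](fx _ _ him); apply: ae_eq_integral_gen.
  by apply: filterS gf => w h Dw; rewrite h.
apply: xget_unique => // y pgy.
have [xs cxs xsE] := norming_functional k (y - x)%R.
apply/eqP; rewrite -subr_eq0; apply/eqP; apply: (rnorm0_eq0 (k := k)).
have [h _] := pgx xs cxs; have [h' _] := pgy xs cxs.
rewrite -xsE linearB reD reN.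
by move: h; rewrite h' => -[->]; rewrite subrr.
Qed.

End on_a_set.
End pettis.

(** * The variation of the indefinite integral *)

Section variation.
Context d (T : measurableType d) (R : realType).
Variable mu : {measure set T -> \bar R}.
Context (K : numFieldType) (k : RC R K).

Lemma strongly_measurable_simple_limit (X : normedModType K) (F : T -> X) :
  strongly_measurable mu F ->
  exists2 f, simple_limit mu f & F = f %[ae mu].
Proof.
move=> [s [ss [Z [mZ Z0 sZ]]]].
exists (fun t => if t \in ~` Z then F t else 0%R); last first.
  exists Z; split => // t /= h; apply: contrapT => Zt; apply: h => _.
  by rewrite mem_set.
exists (fun n t => if t \in ~` Z then s n t else 0%R).
split=> [n|t]; last first.
  case: ifPn => [/set_mem Zt|_]; last exact: cvg_cst.
  by apply: contrapT => h; apply: Zt; exact: sZ.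
have fs := simple_finite_supportW (ss n).
have fZ := finitely_valued_mem (measurableC mZ).
have [fin m] : finitely_valued (fun t => if t \in ~` Z then s n t else 0%R).
  exact: (finitely_valued_comp (fun y : X * bool => if y.2 then y.1 else 0%R)
    (finitely_valued_pair fs fZ)).
split => //; have [_ _] := ss n.
apply: le_lt_trans; apply: le_measure; rewrite ?inE.
- exact: (finitely_valued_preimage [set x : X | x != 0%R] (conj fin m)).
- exact: (finitely_valued_preimage [set x : X | x != 0%R] fs).
- by move=> w /=; case: ifP => //; rewrite eqxx.
Qed.

Section indefinite_integral.
Variables (X : normedModType K) (f : T -> X) (nu : set T -> X).
Local Notation N := (@rnorm R K k X).
Hypothesis slf : simple_limit mu f.
Hypothesis fnu : forall B, finite_measurable mu B ->
  has_integral mu k B f (nu B).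

Let mNf : measurable_fun setT (fun t => (N (f t))%:E).
Proof.
apply/measurable_EFinP; exact: measurable_rnorm (simple_limit_pointwise slf).
Qed.

Let Nf0 t : 0 <= (N (f t))%:E.
Proof. by rewrite lee_fin rnorm_ge0. Qed.

Lemma rnorm_nu_le B : finite_measurable mu B ->
  (N (nu B))%:E <= \int[mu]_(t in B) (N (f t))%:E.
Proof.
move=> fB; rewrite -[nu B]subr0.
apply: le_trans (rnorm_dist_has_integral fB.1 (fnu fB)
  (has_integral0 mu k X B)) _.
by under eq_integral do rewrite subr0.
Qed.

Lemma variation_le A : measurable A ->
  vector_variation mu k nu A <= \int[mu]_(t in A) (N (f t))%:E.
Proof.
move=> mA; apply: ge_ereal_sup => _ [n [E [fE EA tE ->]]].
rewrite -sumEFin.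
apply: (@le_trans _ _ (\sum_(j < n) \int[mu]_(t in E j) (N (f t))%:E)).
  by apply: lee_sum => j _; exact: rnorm_nu_le.
rewrite -ge0_integral_bigsetU//.
- apply: ge0_subset_integral => //.
  + by apply: bigsetU_measurable => j _; exact: (fE j).1.
  + exact: measurable_funTS.
  + by elim/big_ind : _ => // B C BA CA; rewrite subUset.
- by move=> j; exact: (fE j).1.
- exact: index_enum_uniq.
- by apply: sub_trivIset tE.
- exact: measurable_funTS.
Qed.

(** With [z] the integral of the constant [y] over [B], the integral of the norm
of [y] is the norm of [z].  Replacing [f] by [y], and then [z] by [nu B], costs
the mean distance of [f] to [y] each time, whence the factor [2]. *)
Lemma integral_le_near_cst B y : finite_measurable mu B ->
  \int[mu]_(t in B) (N (f t))%:E <=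
  (N (nu B))%:E + 2%:E * \int[mu]_(t in B) (N (f t - y))%:E.
Proof.
move=> fB; have [mB muB] := fB.
have muBB : mu (B `&` B) < +oo by rewrite setIid.
have hy := has_integral_chi k mB y mB muBB.
rewrite setIid in hy.
have chiE t : t \in B -> chi B (cst y) t = y.
  by move=> tB; rewrite /chi indicE tB scale1r.
set z : X := (_ *: _)%R in hy.
have zE : (N z)%:E = \int[mu]_(t in B) (N y)%:E.
  rewrite integral_cst// /z rnormZ abs_ofR re_ofR ger0_norm ?fine_ge0//.
  by rewrite muleC EFinM fineK// ge0_fin_numE.
have mfy : measurable_fun B (fun t => (N (f t - y))%:E).
  apply/measurable_EFinP; apply: measurable_funTS; apply: measurable_rnorm.
  apply: (@pointwise_measurableB _ _ _ _ f (cst y)).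
    exact: simple_limit_pointwise slf.
  by apply: finitely_valued_pointwise; exact: finitely_valued_cst.
have dz : (N (z - nu B))%:E <= \int[mu]_(t in B) (N (f t - y))%:E.
  rewrite rnormB (le_trans (rnorm_dist_has_integral mB (fnu fB) hy))//.
  by rewrite (eq_integral (fun t => (N (f t - y))%:E))// => t tB; rewrite chiE.
have fy0 t : 0 <= (N (f t - y))%:E by rewrite lee_fin rnorm_ge0.
apply: (@le_trans _ _ (\int[mu]_(t in B) ((N (f t - y))%:E + (N y)%:E))).
  apply: ge0_le_integral => //.
  - exact: measurable_funTS.
  - exact: emeasurable_funD.
  - by move=> t _; rewrite -EFinD lee_fin -{1}[f t](subrK y) rnormD.
rewrite ge0_integralD//; last by move=> t _; rewrite lee_fin rnorm_ge0.
rewrite -zE (_ : 2%:E = 1 + 1)// ge0_muleDl// mul1e addeCA leeD2l//.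
apply: (@le_trans _ _ ((N (nu B))%:E + (N (z - nu B))%:E)); last first.
  by rewrite leeD2l.
by rewrite -EFinD lee_fin addrC -{1}[z](subrK (nu B)) rnormD.
Qed.

(** The level sets of a simple approximation partition [B] into pieces on which
[f] is close to a constant in the mean. *)
Lemma integral_le_variation_finite A B : finite_measurable mu B -> B `<=` A ->
  \int[mu]_(t in B) (N (f t))%:E <= vector_variation mu k nu A.
Proof.
move=> fB BA; have [mB muB] := fB.
have [t [a [ts aE a0]]] := simple_approximation mB slf (fnu fB).1.
suff key n : \int[mu]_(w in B) (N (f w))%:E <=
    vector_variation mu k nu A +
    2%:E * \int[mu]_(w in B) (N (f w - t n w))%:E.
  apply/lee_addgt0Pr => e e0.
  have e20 : (0 < e / 2)%R by rewrite divr_gt0.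
  move/cvgr0Pnorm_le: a0 => /(_ _ e20)[M _ hM].
  apply: le_trans (key M) _; rewrite leeD2l// aE -EFinM lee_fin.
  rewrite -ler_pdivlMl// mulrC (le_trans _ (hM M (leqnn M)))//.
  exact: ler_norm.
have [tfin mt _] := ts n.
have ft := simple_finite_supportW (ts n).
have [r rE] := (finite_seqP _).1 tfin.
pose E y := B `&` t n @^-1` [set y].
have mE y : measurable (E y) by exact: measurableI.
have fE y : finite_measurable mu (E y).
  split => //; apply: le_lt_trans muB; apply: le_measure; rewrite ?inE//.
  exact: subIsetl.
have tE (D : set X) : trivIset D E.
  by move=> y z _ _ [w [[_ /= <-] [_ /= <-]]].
have BE : B = \big[setU/set0]_(y <- undup r) E y.
  rewrite -bigcup_seq; apply/seteqP; split=> [w Bw|w [y _ []]//].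
  by exists (t n w) => //=; have : range (t n) (t n w) by [exists w];
    rewrite rE mem_undup.
have mft : measurable_fun setT (fun w => (N (f w - t n w))%:E).
  apply/measurable_EFinP; apply: measurable_rnorm; apply: pointwise_measurableB.
    exact: simple_limit_pointwise slf.
  exact: finitely_valued_pointwise.
have split_int (g : T -> \bar R) : measurable_fun setT g ->
    (forall w, 0 <= g w) ->
    \int[mu]_(w in B) g w = \sum_(y <- undup r) \int[mu]_(w in E y) g w.
  move=> mg g0; rewrite [in LHS]BE ge0_integral_bigsetU// ?undup_uniq//.
  exact: measurable_funTS.
rewrite !split_int//; last by move=> w; rewrite lee_fin rnorm_ge0.
rewrite ge0_sume_distrr; last first.
  by move=> y _; apply: integral_ge0 => w _; rewrite lee_fin rnorm_ge0.
apply: (@le_trans _ _ (\sum_(y <- undup r) ((N (nu (E y)))%:E +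
    2%:E * \int[mu]_(w in E y) (N (f w - t n w))%:E))).
  apply: lee_sum => y _; apply: le_trans (integral_le_near_cst y (fE y)) _.
  rewrite leeD2l// (eq_integral (fun w => (N (f w - t n w))%:E))//.
  by move=> w /set_mem[_ /= ->].
rewrite big_split/= leeD2r// sumEFin big_tnth; apply: ereal_sup_ubound.
exists (size (undup r)), (fun j => E (tnth (in_tuple (undup r)) j)).
split => //; first by move=> j; apply: subset_trans BA; exact: subIsetl.
move=> i j _ _ h; apply/val_inj/eqP.
have := tE setT _ _ I I h.
rewrite !(tnth_nth 0%R) /= => /eqP.
by rewrite nth_uniq ?undup_uniq//.
Qed.

(** Monotone convergence along the increasing sets [U n], which have finite
measure and outside whose union [f] vanishes. *)
Lemma variation_indefinite_integral A : measurable A ->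
  vector_variation mu k nu A = \int[mu]_(t in A) (N (f t))%:E.
Proof.
move=> mA; apply/eqP; rewrite eq_le variation_le//=.
have [s [ss sf]] := slf.
pose S n := [set t | s n t != 0%R].
have mS n : measurable (S n).
  exact: (finitely_valued_preimage [set x : X | x != 0%R]
    (simple_finite_supportW (ss n))).
pose U n := A `&` \big[setU/set0]_(j < n) S j.
have mbS n : measurable (\big[setU/set0]_(j < n) S j).
  exact: bigsetU_measurable.
have mU n : measurable (U n) by exact: measurableI.
have -> : \int[mu]_(t in A) (N (f t))%:E =
    \int[mu]_(t in \bigcup_n U n) (N (f t))%:E.
  rewrite integral_mkcond [RHS]integral_mkcond; congr (integral _ _ _).
  apply/funext => t; rewrite !patchE; case: ifPn => tA; case: ifPn => tU //.
    have -> : f t = 0%R; last by rewrite rnorm0.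
    have s0 n : s n t = 0%R; last first.
      have := sf t; rewrite (_ : (fun n => s n t) = cst 0%R); last exact/funext.
      by move=> h; apply: cvg_unique h (cvg_cst _).
    apply: contrapT => /eqP snt.
    move/negP : tU; apply; apply/mem_set; exists n.+1 => //.
    split; first exact: set_mem.
    by rewrite -bigcup_mkord; exists n => /=.
  by move/set_mem : tU => [n _ [/mem_set]]; rewrite (negbTE tA).
have fU n : finite_measurable mu (U n).
  split => //; suff : mu (\big[setU/set0]_(j < n) S j) < +oo.
    by apply: le_lt_trans; apply: le_measure; rewrite ?inE//; exact: subIsetr.
  elim: n => [|n ih]; first by rewrite big_ord0 measure0.
  rewrite big_ord_recr /=; apply: (le_lt_trans (measureU2 mu (mbS n) (mS n))).
  by rewrite lte_add_pinfty//; have [_ _] := ss n.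
have ndU : nondecreasing_seq U.
  move=> m n mn; rewrite subsetEset; apply: setIS.
  rewrite -!bigcup_mkord => t [j /= jm Sj]; exists j => //=.
  exact: leq_trans mn.
have cvU : \int[mu]_(t in U n) (N (f t))%:E @[n --> \oo] -->
    \int[mu]_(t in \bigcup_n U n) (N (f t))%:E.
  apply: ge0_nondecreasing_set_cvg_integral => // n.
  exact: measurable_funTS.
rewrite -(cvg_lim _ cvU)//; apply: lime_le.
  by apply/cvg_ex; eexists; exact: cvU.
apply: nearW => n; apply: integral_le_variation_finite => //.
exact: subIsetl.
Qed.

End indefinite_integral.
End variation.

Theorem proposition3p8 (R : realType) (K : numFieldType) (k : RC R K)
  (d : measure_display) (T : measurableType d) (mu : {measure set T -> \bar R})
  (X : completeNormedModType K) (F : T -> X) :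
  locally_determined mu ->
  locally_bochner_integrable mu k F ->
  forall A : set T, measurable A ->
    vector_variation mu k (pettis_measure mu k F) A =
    \int[mu]_(t in A) (rnorm k (F t))%:E.
Proof.
move=> _ [/strongly_measurable_simple_limit[f slf Ff] locF] A mA.
have fint B : finite_measurable mu B -> norm_integrable mu k B f.
  move=> fB; split; first exact: simple_limit_pointwise slf.
  have [_ [g gi Fg]] := locF B fB.
  have [mB _] := fB.
  have giB : mu.-integrable B (EFin \o g).
    exact: integrableS gi.
  rewrite (_ : \int[mu]_(t in B) _ = \int[mu]_(t in B) (EFin \o g) t).
    by have /integrable_fin_num/= := giB; rewrite fin_numElt => /(_ mB)/andP[].
  apply: ae_eq_integral_gen.
  move: Fg Ff; apply: filterS2 => t gt Ft Bt /=.
  by rewrite -gt// /chi indicE mem_set// scale1r Ft.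
have fnu B : finite_measurable mu B ->
    has_integral mu k B f (pettis_measure mu k F B).
  move=> fB; have [x fx] := has_integral_exists fB.1 slf (fint B fB).
  rewrite /pettis_measure (has_integral_pettis fx)//.
  move: Ff; apply: filterS => t Ft Bt.
  by rewrite /chi indicE mem_set// scale1r Ft.
rewrite (variation_indefinite_integral slf fnu mA).
apply: ae_eq_integral_gen; move: Ff; apply: filterS => t Ft At.
by rewrite Ft.
Qed.
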